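(* Let $\mathcal{V}=(\mathcal{T},\alpha,\nu)$ be a (transverse taut) veering triangulation of $M$ and let $Y$ be a spanning tree of its dual graph $X$. Then the images of the $\mathbb{Z}[H]$-homomorphisms $D^L:\mathbb{Z}[H]^F\to\mathbb{Z}[H]^E$ and $D^L_Y:\mathbb{Z}[H]^{F_Y}\to\mathbb{Z}[H]^E$ are equal.
   Context: $M$ is a compact, oriented, connected 3-manifold with a finite positive number of toroidal boundary components (viewed as cusps), with an ideal triangulation $\mathcal{T}=(T,F,E)$: $T,F,E$ are the sets of ideal tetrahedra, triangles and edges, with $|T|=|E|=n$, $|F|=2n$. Transverse taut: a coorientation $\alpha$ is given on every triangle such that for each tetrahedron $t$ two faces (the top faces) are cooriented out of $t$ and two (the bottom faces) into $t$; $t$ is immediately below its top faces and immediately above its bottom faces. The top (bottom) diagonal of $t$ is the common edge of its two top (bottom) faces; the other four edges are equatorial. Assign angle $\pi$ to the two diagonals and $0$ to the equatorial edges; it is required that for each $e\in E$ the angles over all embeddings of $e$ into tetrahedra sum to $2\pi$. So each $e$ is the top diagonal of exactly one tetrahedron (the one immediately below $e$). Veering: a transverse taut triangulation with a colouring $\nu$ of the edges red/blue such that in each tetrahedron, viewed from above (coorientation towards the viewer, using the orientation of $M$) and drawn as a quadrilateral with vertical top diagonal and horizontal bottom diagonal, the equatorial edges of positive slope are red and those of negative slope are blue. Let $H=H_1(M;\mathbb{Z})/\text{torsion}$, $M^{ab}\to M$ the maximal free abelian cover (deck group $H$, written multiplicatively), and $\mathcal{V}^{ab}$ the lifted veering triangulation.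 Fix a connected fundamental domain whose closure is triangulated by one lift $1\cdot t$ of each $t\in T$; other tetrahedra are $h\cdot t$, $h\in H$. Triangles and edges of $\mathcal{V}^{ab}$ inherit their $H$-coefficient from the unique tetrahedron immediately below them. Free abelian groups on triangles/edges of $\mathcal{V}^{ab}$ are identified with $\mathbb{Z}[H]^F,\mathbb{Z}[H]^E$. $D^L:\mathbb{Z}[H]^F\to\mathbb{Z}[H]^E$ is the $\mathbb{Z}[H]$-homomorphism with $D^L(1\cdot f)=x_0-x_1-x_2$, where $x_0,x_1,x_2$ are the edges of $1\cdot f$ in $\mathcal{V}^{ab}$ and $x_0$ is the one that is the top diagonal of the tetrahedron immediately below $1\cdot f$. The dual graph $X$ of $\mathcal{T}$ has a vertex for each $t\in T$ and an edge for each $f\in F$, joining the two tetrahedra (possibly equal) containing $f$. For a spanning tree $Y$ of $X$, $F_Y\subset F$ is the set of triangles dual to edges of $X$ not in $Y$, and $D^L_Y:\mathbb{Z}[H]^{F_Y}\to\mathbb{Z}[H]^E$ is obtained from $D^L$ by deleting the columns corresponding to the edges of $Y$ (i.e. restricting to $\mathbb{Z}[H]^{F_Y}$). *)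

(* Defs.v *)
From HB Require Import structures.
From Stdlib Require Import Relation_Operators.
From mathcomp Require Import all_boot all_algebra perm.
From mathcomp Require Import generic_quotient ring_quotient finmap.
From mathcomp Require Import boolp classical_sets.
From mathcomp Require Import monalg.

Set Implicit Arguments.
Unset Strict Implicit.
Unset Printing Implicit Defensive.

Import GRing.Theory.
Local Open Scope ring_scope.

(* The integral group ring Z[H] of an additively written abelian group H.
   The ring structure that monalg puts on {malg int[H]} requires a monoid
   without nontrivial units, hence the separate instance below; the group
   element h is << h >>. *)
Section GroupRing.
Context (H : zmodType).

Definition grpring : Type := {malg int[H]}.

HB.instance Definition _ := GRing.Zmodule.on grpring.

Implicit Types g : grpring.

Definition gr_elt (h : H) : grpring := << h >>.

Definition gr_one : grpring := gr_elt 0.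

Definition gr_mul g1 g2 : grpring :=
  \sum_(h1 <- msupp g1) \sum_(h2 <- msupp g2) << g1@_h1 * g2@_h2 *g h1 + h2 >>.

Lemma gr_mulw (d1 d2 : {fset H}) g1 g2 :
  (msupp g1 `<=` d1)%fset -> (msupp g2 `<=` d2)%fset ->
  gr_mul g1 g2 = \sum_(h1 <- d1) \sum_(h2 <- d2) << g1@_h1 * g2@_h2 *g h1 + h2 >>.
Proof.
move=> le_d1 le_d2; rewrite /gr_mul (big_fset_incl _ le_d1) /=.
  apply/eq_bigr=> k1 _; apply/big_fset_incl => // k _ /mcoeff_outdom ->.
  by rewrite mulr0 monalgU0.
move=> k _ /mcoeff_outdom g1k.
by rewrite big1 => // k' _; rewrite g1k mul0r monalgU0.
Qed.

Lemma gr_mulC : commutative gr_mul.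
Proof.
move=> x y; rewrite /gr_mul exchange_big /=.
by apply/eq_bigr=> a _; apply/eq_bigr=> b _; rewrite mulrC addrC.
Qed.

Lemma gr_mulDl : left_distributive gr_mul +%R.
Proof.
move=> g1 g2 g.
rewrite (gr_mulw (msuppD_le g1 g2) (fsubset_refl (msupp g))).
rewrite (gr_mulw (fsubsetUl _ (msupp g2)) (fsubset_refl (msupp g))).
rewrite (gr_mulw (fsubsetUr (msupp g1) _) (fsubset_refl (msupp g))).
rewrite -big_split /=; apply/eq_bigr=> k1 _.
rewrite -big_split /=; apply/eq_bigr=> k2 _.
by rewrite mcoeffD mulrDl monalgUD.
Qed.

Lemma gr_mulDr : right_distributive gr_mul +%R.
Proof. by move=> x y z; rewrite gr_mulC gr_mulDl !(gr_mulC x). Qed.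

Lemma gr_mul0g : left_zero 0 gr_mul.
Proof. by move=> g; rewrite /gr_mul msupp0 big_seq_fset0. Qed.

Lemma gr_mulg0 : right_zero 0 gr_mul.
Proof. by move=> g; rewrite gr_mulC gr_mul0g. Qed.

Lemma gr_mulUg c k g :
  gr_mul << c *g k >> g = \sum_(k' <- msupp g) << c * g@_k' *g k + k' >>.
Proof.
rewrite (gr_mulw msuppU_le (fsubset_refl _)) big_seq_fset1.
by apply/eq_bigr => k' _; rewrite mcoeffUU.
Qed.

Lemma gr_mulUU c1 c2 k1 k2 :
  gr_mul << c1 *g k1 >> << c2 *g k2 >> = << c1 * c2 *g k1 + k2 >>.
Proof.
by rewrite (gr_mulw msuppU_le msuppU_le) !big_seq_fset1 !mcoeffUU.
Qed.

Lemma gr_mul1g : left_id gr_one gr_mul.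
Proof.
move=> g; rewrite gr_mulUg [RHS]monalgE.
by apply/eq_bigr=> kg _; rewrite mul1r add0r.
Qed.

Lemma gr_mulA : associative gr_mul.
Proof.
have mull (a : grpring) : {morph gr_mul a : x y / x + y} by move=> x y; apply: gr_mulDr.
have mulr (a : grpring) : {morph gr_mul^~ a : x y / x + y} by move=> x y; apply: gr_mulDl.
have sumE (g : grpring) := monalgE g.
have mulsl (I : Type) (r : seq I) (F : I -> grpring) a :
    gr_mul a (\sum_(i <- r) F i) = \sum_(i <- r) gr_mul a (F i).
  exact: (big_morph _ (mull a) (gr_mulg0 a)).
have mulsr (I : Type) (r : seq I) (F : I -> grpring) a :
    gr_mul (\sum_(i <- r) F i) a = \sum_(i <- r) gr_mul (F i) a.
  exact: (big_morph _ (mulr a) (gr_mul0g a)).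
clear mull mulr; move: gr_mul gr_mulUU mulsl mulsr => m mUU mulsl mulsr.
move=> g1 g2 g3; rewrite (sumE g1) !mulsr; apply/eq_bigr => a _.
rewrite (sumE g2) !(mulsl, mulsr); apply/eq_bigr => b _.
rewrite (sumE g3) !mulsl; apply/eq_bigr => c _.
by rewrite !mUU mulrA addrA.
Qed.

Lemma gr_one_neq0 : gr_one != 0.
Proof. by rewrite monalgU_eq0. Qed.

HB.instance Definition _ := GRing.Zmodule_isComNzRing.Build grpring
  gr_mulA gr_mulC gr_mul1g gr_mulDl gr_one_neq0.

End GroupRing.

(* R^X for a finite set X, with its R-module structure. *)
Definition freemod (R : comNzRingType) (X : finType) : Type := {ffun X -> R^o}.
HB.instance Definition _ (R : comNzRingType) (X : finType) :=
  GRing.Lmodule.on (freemod R X).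

(* The R-linear map R^X -> M sending the basis vector of x to col x. *)
Section LinComb.
Context (R : comNzRingType) (M : lmodType R) (X : finType) (col : X -> M).

Definition lincomb (v : freemod R X) : M := \sum_x (v x : R) *: col x.

Lemma lincomb_is_linear : linear lincomb.
Proof.
move=> a u v; rewrite /lincomb scaler_sumr -big_split /=.
by apply: eq_bigr => x _; rewrite !ffunE scalerDl scalerA.
Qed.

HB.instance Definition _ :=
  GRing.isLinear.Build R (freemod R X) M *:%R lincomb lincomb_is_linear.
End LinComb.

(* Quotient of a finite set by the equivalence relation generated by r, for r
   such that connect r is symmetric. *)
Section Classes.
Context (X : finType) (r : rel X).

Definition eqclass (x : X) : {set X} := [set y | connect r x y].

Definition classes_of := {A : {set X} | A \in [set eqclass x | x : X]}.
HB.instance Definition _ := Finite.on classes_of.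

Definition class_of (x : X) : classes_of :=
  exist _ (eqclass x) (imset_f eqclass (isT : x \in predT)).

Definition members (c : classes_of) : {set X} := sval c.
End Classes.

(* Face pairings of tetrahedra. A tetrahedron t has vertices 'I_4, and its face
   i is the one opposite to the vertex i. With (t', s) := glue t i, the face i
   of t is identified with the face s i of t', the vertex a != i of t being
   identified with the vertex s a of t'.
   The vertices 0, 1, 2, 3 of each tetrahedron are numbered in accordance with
   the orientation of M: det (v1 - v0, v2 - v0, v3 - v0) > 0 in oriented
   charts. Hence the orientations match when each s is odd. *)
Definition edge_in_tet := {p : {set 'I_4} | #|p| == 2}.

Section Gluing.
Context (T : finType) (glue : T -> 'I_4 -> T * 'S_4).

(* A side is a face of a tetrahedron; a triangle is a pair of mated sides. *)
Definition side : Type := (T * 'I_4)%type.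
HB.instance Definition _ := Finite.on side.

Definition mate (x : side) : side :=
  ((glue x.1 x.2).1, (glue x.1 x.2).2 x.2).

Definition adj_tet : rel T := [rel t t' | [exists i, (mate (t, i)).1 == t']].

Definition triangle := classes_of [rel x y | mate x == y].
HB.instance Definition _ := Finite.on triangle.
Definition triangle_of (x : side) : triangle := class_of _ x.

(* The embedding (t, p) of an edge is carried to (t', p') by the identification
   along the face i of t, which contains p. *)
Definition carry_edge (i : 'I_4) : rel (T * edge_in_tet) :=
  [rel x y : T * edge_in_tet | [&& i \notin sval x.2, y.1 == (glue x.1 i).1 &
               sval y.2 == (glue x.1 i).2 @: sval x.2]].

Definition edge := classes_of [rel x y : T * edge_in_tet | [exists i, carry_edge i x y]].
HB.instance Definition _ := Finite.on edge.
Definition edge_of (x : T * edge_in_tet) : edge := class_of _ x.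

(* Ideal vertices, i.e. boundary components of M. The link of an ideal vertex v
   is the closed surface tiled by the triangles truncating the corners (t, a) in
   v. Its vertices are the ends (t, (a, b)) of the edges {a, b} of t at a; its
   edges are the arcs (t, (a, b)) in which the truncating triangle at a meets
   the face b of t. *)
Definition ideal_vertex :=
  classes_of [rel x y : T * 'I_4 |
    [exists i, (i != x.2) && (y == ((glue x.1 i).1, (glue x.1 i).2 x.2))]].
HB.instance Definition _ := Finite.on ideal_vertex.

Definition same_end : rel (T * ('I_4 * 'I_4)) := [rel x y |
  [exists i, [&& i != x.2.1, i != x.2.2 &
    y == ((glue x.1 i).1, ((glue x.1 i).2 x.2.1, (glue x.1 i).2 x.2.2))]]].

Definition same_arc : rel (T * ('I_4 * 'I_4)) := [rel x y |
  y == ((glue x.1 x.2.2).1,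
        ((glue x.1 x.2.2).2 x.2.1, (glue x.1 x.2.2).2 x.2.2))].

Definition link_vertices (v : ideal_vertex) :=
  [set eqclass same_end x | x : T * ('I_4 * 'I_4)
    & ((x.1, x.2.1) \in members v) && (x.2.1 != x.2.2)].

Definition link_edges (v : ideal_vertex) :=
  [set eqclass same_arc x | x : T * ('I_4 * 'I_4)
    & ((x.1, x.2.1) \in members v) && (x.2.1 != x.2.2)].

(* The links are closed connected oriented surfaces, so they are tori exactly
   when their Euler characteristic is 0. *)
Record is_ideal_triangulation : Prop := IsIdealTriangulation {
  tet_nonempty : (0 < #|T|)%N;
  tet_connected : forall t t', connect adj_tet t t';
  glueK : forall t i, let: (t', s) := glue t i in glue t' (s i) = (t, s^-1%g);
  glue_neq : forall x, mate x != x;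
  glue_odd : forall t i, odd_perm (glue t i).2;
  toroidal_cusps : forall v : ideal_vertex,
    (#|link_vertices v| + #|members v| = #|link_edges v|)%N
}.

(* A coorientation of the triangles is given by up : side -> bool, where
   up (t, i) means that the face i of t is cooriented out of t. *)
Section Taut.
Variable up : side -> bool.

Definition top_diag (t : T) : {set 'I_4} := \bigcap_(i | up (t, i)) [set~ i].
Definition bot_diag (t : T) : {set 'I_4} := \bigcap_(i | ~~ up (t, i)) [set~ i].

(* Angles are in units of pi. *)
Definition angle (x : T * edge_in_tet) : nat :=
  (sval x.2 == top_diag x.1) || (sval x.2 == bot_diag x.1).

Record is_transverse_taut : Prop := IsTransverseTaut {
  up_mate : forall x, up (mate x) = ~~ up x;
  two_top_faces : forall t, #|[set i | up (t, i)]| = 2;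
  angle_sum : forall e : edge, (\sum_(x in members e) angle x = 2)%N
}.

(* Viewed from above, t is drawn with its top diagonal from the north vertex n
   to the south vertex s, and its bottom diagonal from the west vertex w to the
   east vertex e. Since ns is closer to the viewer than we, n, s, w, e are in
   the order given by the orientation of M. *)
Inductive colour := red | blue.

Definition is_veering (nu : edge -> colour) : Prop :=
  forall (t : T) (sigma : 'S_4),
    let n := sigma (inord 0) in let s := sigma (inord 1) in
    let w := sigma (inord 2) in let e := sigma (inord 3) in
    ~~ odd_perm sigma -> top_diag t = [set n; s] -> bot_diag t = [set w; e] ->
  forall p : edge_in_tet,
    (sval p = [set w; n] \/ sval p = [set s; e] -> nu (edge_of (t, p)) = red) /\
    (sval p = [set n; e] \/ sval p = [set w; s] -> nu (edge_of (t, p)) = blue).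
End Taut.
End Gluing.

Record veering_triangulation := VeeringTriangulation {
  tet :> finType;
  glue : tet -> 'I_4 -> tet * 'S_4;
  up : side tet -> bool;
  nu : edge glue -> colour;
  vt_triangulation : is_ideal_triangulation glue;
  vt_taut : is_transverse_taut glue up;
  vt_veering : is_veering up nu
}.

Section Veering.
Variable V : veering_triangulation.

Notation F := (triangle (@glue V)).
Notation E := (edge (@glue V)).
Notation mate := (mate (@glue V)).
Notation triangle_of := (triangle_of (@glue V)).
Notation edge_of := (edge_of (@glue V)).

(* H_1(M; Z) is the cellular homology of the 2-complex dual to the ideal
   triangulation, onto which M deformation retracts: it has a vertex for each
   tetrahedron, an edge for each triangle, oriented by the coorientation, and a
   2-cell for each edge. *)
Definition chain1 : zmodType := {ffun F -> int}.

Definition bd1 (c : chain1) : {ffun V -> int} :=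
  [ffun t => \sum_(f : F) \sum_(x in members f | x.1 == t) (-1) ^+ up x * c f].

Definition cycle_pred : {pred chain1} := fun c => bd1 c == 0.

Lemma cycle_closed : zmod_closed cycle_pred.
Proof.
have bdB c d : bd1 (c - d) = bd1 c - bd1 d.
  apply/ffunP => t; rewrite !ffunE -sumrB; apply: eq_bigr => f _.
  by rewrite -sumrB; apply: eq_bigr => x _; rewrite !ffunE mulrBr.
split; first by rewrite unfold_in /= -(subrr 0) bdB subrr.
by move=> c d; rewrite !unfold_in /= bdB => /eqP -> /eqP ->; rewrite subrr.
Qed.

HB.instance Definition _ := GRing.isZmodClosed.Build chain1 cycle_pred cycle_closed.

Record cycle1 := Cycle1 { chain_of :> chain1; _ : chain_of \in cycle_pred }.
HB.instance Definition _ := [isSub for chain_of].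
HB.instance Definition _ := [Choice of cycle1 by <:].
HB.instance Definition _ := [SubChoice_isSubZmodule of cycle1 by <:].

(* (t, (i, j)) with i != j is the tetrahedron t being crossed from its face j to
   its face i, while turning around the edge common to these two faces. The
   next tetrahedron t' is entered through its face s i and is left through its
   face s j. *)
Definition turn (x : V * ('I_4 * 'I_4)) : V * ('I_4 * 'I_4) :=
  ((glue x.1 x.2.1).1, ((glue x.1 x.2.1).2 x.2.2, (glue x.1 x.2.1).2 x.2.1)).

(* The boundary of a dual 2-cell. *)
Definition loop_around (x : V * ('I_4 * 'I_4)) : chain1 :=
  \sum_(y <- orbit turn x)
    [ffun f => if f == triangle_of (y.1, y.2.1)
               then (if up (y.1, y.2.1) then 1 else -1) else 0].

Definition boundary_pred : {pred cycle1} := fun z =>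
  `[< exists a : V * ('I_4 * 'I_4) -> int,
        chain_of z = \sum_(x | x.2.1 != x.2.2) loop_around x *~ a x >].

Lemma boundary_closed : zmod_closed boundary_pred.
Proof.
split=> [|y z]; rewrite !unfold_in.
  apply/asboolP; exists (fun=> 0).
  by rewrite big1 // => x _; rewrite mulr0z.
move=> /asboolP[a ya] /asboolP[b zb]; apply/asboolP.
exists (fun x => a x - b x); rewrite [LHS]/= ya zb -sumrB.
by apply: eq_bigr => x _; rewrite mulrzBr.
Qed.

HB.instance Definition _ :=
  GRing.isZmodClosed.Build cycle1 boundary_pred boundary_closed.

Definition boundaries : zmodClosed cycle1 := boundary_pred.

Definition H1 : zmodType := Quotient.quot boundaries.

Definition torsion_pred : {pred H1} := fun x =>
  `[< exists2 k : nat, (0 < k)%N & x *+ k = 0 >].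

Lemma torsion_closed : zmod_closed torsion_pred.
Proof.
split=> [|y z]; rewrite !unfold_in.
  by apply/asboolP; exists 1%N; rewrite ?mul0rn.
move=> /asboolP[k k0 yk] /asboolP[l l0 zl]; apply/asboolP.
exists (k * l)%N; first by rewrite muln_gt0 k0.
by rewrite mulrnBl mulrnA yk mul0rn mulnC mulrnA zl mul0rn subrr.
Qed.

HB.instance Definition _ :=
  GRing.isZmodClosed.Build H1 torsion_pred torsion_closed.

Definition torsion : zmodClosed H1 := torsion_pred.

(* The group H is written additively. *)
Definition H : zmodType := Quotient.quot torsion.

Definition homology_class (z : cycle1) : H :=
  (\pi_(Quotient.quot torsion) (\pi_(Quotient.quot boundaries) z))%qT.

(* The tetrahedra of the maximal free abelian cover are the h.t, with h : H and
   t : V, once a lift 1.t of each t has been chosen. Such a choice amounts to a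
   1-cochain phi representing the tautological class H_1(M) -> H: for
   a triangle f with the tetrahedron b immediately below and the tetrahedron a
   immediately above, the lift of f which is a top face of h.b is a bottom
   face of (h + phi f).a. *)
Section Cover.
Variable phi : F -> H.

Definition is_lift : Prop :=
  forall z : cycle1, \sum_f phi f *~ chain_of z f = homology_class z.

(* The fundamental domain, the union of the tetrahedra 1.t, is connected
   through the lifts of triangles between two such tetrahedra. *)
Definition domain_adj : rel V :=
  [rel t t' | [exists i, ((mate (t, i)).1 == t') && (phi (triangle_of (t, i)) == 0)]].

Record is_fundamental_domain : Prop := IsFundamentalDomain {
  fd_lift : is_lift;
  fd_connected : forall t t', connect domain_adj t t'
}.

(* The other side of the face i of h.t belongs to the tetrahedron with
   H-coefficient h + crossing (t, i). *)
Definition crossing (x : side V) : H :=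
  if up x then phi (triangle_of x) else - phi (triangle_of x).

(* (h, (t, p)) is the edge p of h.t; edges of the cover are the classes of the
   equivalence relation same_lifted_edge. *)
Definition carry_lifted_edge (x y : H * (V * edge_in_tet)) : Prop :=
  exists2 i, carry_edge (@glue V) i x.2 y.2 & y.1 = x.1 + crossing (x.2.1, i).

Definition same_lifted_edge := clos_refl_sym_trans _ carry_lifted_edge.

(* The H-coefficient of the edge p of 1.t in the cover: the one of the
   tetrahedron immediately below this edge, i.e. having it as top diagonal. The
   latter exists and is unique; 0 is a dummy value. *)
Definition edge_coef (x : V * edge_in_tet) : H :=
  xget 0 [set h | exists2 y, sval y.2 = top_diag (@up V) y.1
                           & same_lifted_edge (h, y) (0, x)]%classic.

Notation ZH := (grpring H).

(* The edge p of 1.t in the cover, as an element of Z[H]^E. *)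
Definition lifted_edge (x : V * edge_in_tet) : freemod ZH E :=
  [ffun e => if e == edge_of x then gr_elt (edge_coef x) else 0].

(* The image of 1.f. The outer sum has a single term, the side x of f
   in the tetrahedron x.1 immediately below f. *)
Definition DL_col (f : F) : freemod ZH E :=
  \sum_(x in members f | up x)
    \sum_(p : edge_in_tet | x.2 \notin sval p)
      (if sval p == top_diag (@up V) x.1
       then lifted_edge (x.1, p) else - lifted_edge (x.1, p)).

Definition DL : {linear freemod ZH F -> freemod ZH E} := lincomb DL_col.

Section Tree.
Variable Y : {set F}.

(* A cycle of a graph with multiple edges and loops, in the dual graph: each
   side is an edge of the dual graph directed out of its tetrahedron. *)
Definition graph_cycle (c : seq (side V)) : bool :=
  [&& c != [::], cycle [rel x y | (mate x).1 == y.1] c,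
      uniq [seq x.1 | x <- c] & uniq [seq triangle_of x | x <- c]].

Record spanning_tree : Prop := SpanningTree {
  tree_connected : forall t t' : V,
    connect [rel u u' | [exists i, ((mate (u, i)).1 == u')
                                 && (triangle_of (u, i) \in Y)]] t t';
  tree_acyclic : forall c, graph_cycle c -> ~~ all [in Y] [seq triangle_of x | x <- c]
}.

Definition off_tree := {f : F | f \notin Y}.
HB.instance Definition _ := Finite.on off_tree.

Definition DL_Y : {linear freemod ZH off_tree -> freemod ZH E} :=
  lincomb (fun f : off_tree => DL_col (sval f)).
End Tree.
End Cover.
End Veering.

(* Main.v *)
Require Import Defs.
From mathcomp Require Import all_boot all_algebra.
From mathcomp Require Import classical_sets.
From Stdlib Require Import Relation_Operators.
From mathcomp Require Import perm boolp.
From mathcomp Require Import finset.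

Set Implicit Arguments.
Unset Strict Implicit.
Unset Printing Implicit Defensive.

Import GRing.Theory.
Local Open Scope ring_scope.

(** The columns of [DL] indexed by the four faces of one tetrahedron sum to
    zero once they are multiplied by suitable units of Z[H]. Granting this, a
    module spanned by columns that contains those of three faces of a
    tetrahedron contains that of the fourth ([fourth_column]). A tree with an
    edge has a leaf: a tetrahedron with one side in the tree and three sides
    off it. So the columns of the faces of [Y] are recovered one after the other
    from the columns off [Y], starting at the leaves ([tree_face_induction]).

    For the relation, draw a tetrahedron t from above, with vertices n, s, w, e
    and top diagonal ns, and write each column in terms of the edges of the
    lift 1.t. Both top faces have ns as distinguished edge (the one with
    coefficient 1). A bottom face is a top face of the tetrahedron t' below it,
    and its distinguished edge is the top diagonal of t'. Going around the face
    counterclockwise, the other two edges are red, then blue, as seen in t',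
    whereas in t the colours after the bottom diagonal we are blue, then red.
    Hence the distinguished edge is not we; it is the edge of the face, other
    than we, that has the same colour as we ([leads_bottom]). So the
    distinguished edges of the two bottom faces are opposite equatorial edges
    of t, and the signed sum of the four columns cancels
    ([tet_faces_relation]).

    Writing all columns in the lift 1.t uses that the H-coefficient of an edge
    is well defined and changes by the displacement when the edge is carried
    from a tetrahedron to a neighbour ([edge_coef_carry]). This needs that each
    edge is the top diagonal of exactly one tetrahedron ([unique_top_diag]) and
    that turning once around an edge is a null-homologous loop
    ([shift_order]). *)

(** * The group ring and free modules *)

Lemma gr_eltD (G : zmodType) (g h : G) :
  gr_elt (g + h) = gr_elt g * gr_elt h :> grpring G.
Proof. by rewrite [RHS]gr_mulUU mulr1. Qed.

Lemma gr_eltK (G : zmodType) (M : lmodType (grpring G)) (h : G) (v : M) :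
  gr_elt h *: (gr_elt (- h) *: v) = v.
Proof. by rewrite scalerA -gr_eltD subrr; exact: scale1r. Qed.

Lemma freemod_delta (R : comNzRingType) (X : finType) (a : X) (r s : R) :
  [ffun e => if e == a then r * s else 0] =
  r *: ([ffun e => if e == a then s else 0] : freemod R X) :> freemod R X.
Proof.
apply/ffunP => e; rewrite !ffunE.
by case: ifP => _; rewrite // scaler0.
Qed.

Lemma lincomb_delta (R : comNzRingType) (M : lmodType R) (X : finType)
  (col : X -> M) x : range (lincomb col) (col x).
Proof.
exists [ffun y => if y == x then 1 else 0] => //.
rewrite /lincomb (bigD1 x) //= ffunE eqxx scale1r big1 ?addr0 // => y yx.
by rewrite ffunE (negbTE yx) scale0r.
Qed.

Lemma range_lincomb_sub (R : comNzRingType) (M : lmodType R) (X X' : finType)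
  (col : X -> M) (col' : X' -> M) :
  (forall x, range (lincomb col') (col x)) ->
  (range (lincomb col) `<=` range (lincomb col'))%classic.
Proof.
move=> colP _ [v _ <-]; apply: (big_ind (range (lincomb col'))).
- by exists 0; rewrite ?raddf0.
- by move=> _ _ [u1 _ <-] [u2 _ <-]; exists (u1 + u2); rewrite ?raddfD.
- by move=> x _; have [u _ <-] := colP x; exists ((v x : R) *: u); rewrite ?linearZ.
Qed.

(** * Classes of a symmetric relation *)

Lemma connect_sub_inv (X : finType) (r : rel X) (P : X -> Prop) x y :
  (forall a b, P a -> r a b -> P b) -> P x -> connect r x y -> P y.
Proof.
move=> Pr Px /connectP[p pth ->] {y}.
by elim: p x Px pth => //= a p IH x Px /andP[xa /IH]; apply; apply: Pr xa.
Qed.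

Lemma connect_sym_sym (X : finType) (r : rel X) :
  symmetric r -> connect_sym r.
Proof.
move=> rs x y; rewrite -[RHS]connect_rev.
by apply: eq_connect => a b; rewrite /= rs.
Qed.

Lemma class_of_eq (X : finType) (r : rel X) x y :
  symmetric r -> r x y -> class_of r x = class_of r y.
Proof.
move=> rs rxy; apply: val_inj => /=; apply/setP => z; rewrite !inE.
by apply: (same_connect (connect_sym_sym rs)); apply: connect1.
Qed.

Lemma mem_class_of (X : finType) (r : rel X) x y :
  (y \in members (class_of r x)) = connect r x y.
Proof. by rewrite inE. Qed.

Lemma class_of_surj (X : finType) (r : rel X) (c : classes_of r) :
  exists x, c = class_of r x.
Proof.
case: c => A /[dup] /imsetP[x _ ->] AP; exists x.
exact: val_inj.
Qed.

(** * Four-element index sets *)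

Lemma ord4_perm_eq (a b c d : 'I_4) :
  uniq [:: a; b; c; d] -> perm_eq (index_enum 'I_4) [:: a; b; c; d].
Proof.
move=> u; apply: uniq_perm => //; first exact: index_enum_uniq.
move=> k; rewrite mem_index_enum; apply/esym.
have /subset_cardP : #|[:: a; b; c; d]| = #|{: 'I_4}|.
  by rewrite (card_uniqP u) card_ord.
by move/elimT => -> //; exact: subset_predT.
Qed.

Lemma big_ord4 (M : nmodType) (G : 'I_4 -> M) (a b c d : 'I_4) :
  uniq [:: a; b; c; d] -> \sum_i G i = G a + G b + G c + G d.
Proof.
move=> u; rewrite (perm_big _ (ord4_perm_eq u)) /=.
by rewrite !big_cons big_nil addr0 !addrA.
Qed.

Lemma big_ord4_neq (M : nmodType) (G : 'I_4 -> M) (a b c d : 'I_4) :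
  uniq [:: a; b; c; d] -> \sum_(j | j != a) G j = G b + G c + G d.
Proof.
move=> u; rewrite big_mkcond (big_ord4 _ u) eqxx add0r.
move: u; rewrite /= !inE !negb_or -!andbA => /and5P[ab ac ad _ _].
by rewrite !(eq_sym _ a) ab ac ad.
Qed.

Lemma uniq4_neq (T : eqType) (a b c d : T) : uniq [:: a; b; c; d] ->
  [/\ (a == b) = false, (a == c) = false & (a == d) = false] *
  [/\ (b == a) = false, (b == c) = false & (b == d) = false] *
  [/\ (c == a) = false, (c == b) = false & (c == d) = false] *
  [/\ (d == a) = false, (d == b) = false & (d == c) = false].
Proof.
rewrite /= !inE !negb_or -!andbA.
case/and5P=> /negbTE ab /negbTE ac /negbTE ad /negbTE bc.
case/and3P=> /negbTE bd /negbTE cd _.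
by rewrite !(eq_sym b a) !(eq_sym c) !(eq_sym d) ab ac ad bc bd cd.
Qed.

Lemma setC2_ord4 (a b c d : 'I_4) :
  uniq [:: a; b; c; d] -> ~: [set a; b] = [set c; d].
Proof.
move=> u; apply/setP => k; rewrite !inE.
have : k \in [:: a; b; c; d] by rewrite -(perm_mem (ord4_perm_eq u)) mem_index_enum.
rewrite !inE; have [[[[ab ac ad] [ba bc bd]] [ca cb cd]] [da db dc]] := uniq4_neq u.
have neq := (ab, ac, ad, ba, bc, bd, ca, cb, cd, da, db, dc).
by case/or4P => /eqP ->; rewrite ?eqxx ?neq ?orbT.
Qed.

(** When [G i j] is the edge common to the faces [i] and [j], and [L i k] the
    column of the face [i] if its distinguished edge is [G i k], both sides
    equal [G w e - G n s - G n e - G s w]: on each side the distinguished edge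
    of the bottom face is one of the other two edges of the top face, and
    cancels. *)
Lemma tet_faces_relation (M : zmodType) (G : 'I_4 -> 'I_4 -> M) (n s w e : 'I_4) :
  (forall i j, G i j = G j i) -> uniq [:: n; s; w; e] ->
  let L i k := \sum_(j | j != i) (if j == k then G i j else - G i j) in
  L s e + L e w = L n w + L w e.
Proof.
move=> Gsym u L.
have Lsum i k a b : uniq [:: i; k; a; b] -> L i k = G i k - G i a - G i b.
  move=> v; rewrite /L (big_ord4_neq _ v) eqxx.
  by have [[_ [_ -> _]] [_ -> _]] := uniq4_neq v.
have aux (a b c d f g : M) : f - a - d + (g - c - f) = b - a - c + (g - b - d).
  have canc (x y z : M) : z - x + (y - z) = y - x by rewrite addrC addrA subrK.
  rewrite -(addrA f) -opprD canc -(addrA b) -opprD (addrAC g (- b)) canc.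
  by rewrite -!addrA -!opprD addrCA (addrC c) [in RHS]addrCA.
have [[[[ns nw ne] [sn sw se]] [wn ws we]] [en es ew]] := uniq4_neq u.
have neq := (ns, nw, ne, sn, sw, se, wn, ws, we, en, es, ew).
rewrite (Lsum s e n w) ?(Lsum e w n s) ?(Lsum n w s e) ?(Lsum w e n s);
  try by rewrite /= !inE !neq.
rewrite (Gsym e s) (Gsym n s) (Gsym n e) (Gsym w e) (Gsym w n) (Gsym w s).
exact: aux.
Qed.

Lemma setC2_eq (A : {set 'I_4}) i j : i != j -> #|A| = 2 ->
  (~: [set i; j] == ~: A) = (i \in A) && (j \in A).
Proof.
move=> ij cA; rewrite (inj_eq (@setC_inj _)) eqEcard cards2 ij cA andbT.
by rewrite subUset !sub1set.
Qed.

(** * Edges coded by the two faces that contain them *)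

Lemma edge_dflt_subproof : #|[set ord0; ord_max : 'I_4]| == 2.
Proof. by rewrite cards2. Qed.

(** The edge of a tetrahedron lying in the faces [i] and [j], the faces being
    named after the opposite vertices. Naming edges by faces turns
    [carry_edge], [turn], the diagonals and the edges of a face into
    statements about which faces are cooriented upwards. The default value
    only matters for [i = j], where there is no such edge. *)
Definition edge_in_faces (i j : 'I_4) : edge_in_tet :=
  insubd (exist (fun p : {set 'I_4} => #|p| == 2) _ edge_dflt_subproof)
         (~: [set i; j]).

Lemma val_edge_in_faces i j :
  i != j -> sval (edge_in_faces i j) = ~: [set i; j].
Proof.
move=> ij; rewrite /edge_in_faces -/(val _) insubdK //.
by rewrite unfold_in /= cardsCs setCK cards2 ij card_ord.
Qed.

Lemma edge_in_facesC i j : edge_in_faces i j = edge_in_faces j i.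
Proof. by congr insubd; rewrite setUC. Qed.

Lemma edge_in_facesP (p : edge_in_tet) :
  exists i j, i != j /\ p = edge_in_faces i j.
Proof.
have /cards2P[i [j] [ij pE]] : #|~: sval p| == 2.
  by rewrite cardsCs setCK (eqP (svalP p)) card_ord.
exists i, j; split=> //; apply: val_inj => /=.
by rewrite val_edge_in_faces // -pE setCK.
Qed.

Lemma edge_in_faces_inj i j k l : i != j -> k != l ->
  edge_in_faces i j = edge_in_faces k l ->
  (i, j) = (k, l) \/ (i, j) = (l, k).
Proof.
move=> ij kl /(congr1 sval); rewrite !val_edge_in_faces // => /setC_inj /setP e.
have := e l; have := e k; rewrite !inE !eqxx !orbT /=.
case/orP=> /eqP ?; subst k.
  rewrite [l == i]eq_sym (negbTE kl) /= => /eqP ->; by left.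
by rewrite [l == j]eq_sym (negbTE kl) orbF => /eqP ->; right.
Qed.

Lemma mem_edge_in_faces i j k :
  i != j -> (k \in sval (edge_in_faces i j)) = (k != i) && (k != j).
Proof. by move=> ij; rewrite val_edge_in_faces // !inE negb_or. Qed.

Lemma imset_edge_in_faces (s : 'S_4) i j : i != j ->
  s @: sval (edge_in_faces i j) = sval (edge_in_faces (s i) (s j)).
Proof.
move=> ij; rewrite !val_edge_in_faces ?(inj_eq perm_inj) //.
apply/setP => k; rewrite -[k](permKV s) mem_imset; last exact: perm_inj.
by rewrite !inE !(inj_eq perm_inj).
Qed.

Lemma big_edges_of_face (M : nmodType) (i : 'I_4) (G : edge_in_tet -> M) :
  \sum_(p : edge_in_tet | i \notin sval p) G p =
  \sum_(j | j != i) G (edge_in_faces i j).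
Proof.
(* The default value is different from [i], so that [h] never takes the
   value [i], for which [edge_in_faces i i] is meaningless. *)
pose h (p : edge_in_tet) :=
  odflt (lift i ord0) [pick j | (j != i) && (j \notin sval p)].
have hi p : h p != i.
  rewrite /h; case: pickP => [k /andP[] //|_] /=.
  by rewrite eq_sym neq_lift.
have hK j : j != i -> h (edge_in_faces i j) = j.
  move=> ji; have ij : i != j by rewrite eq_sym.
  rewrite /h; case: pickP => [k|/(_ j)]; rewrite mem_edge_in_faces //.
    by case/andP=> -> /=; rewrite negbK => /eqP.
  by rewrite ji eqxx.
rewrite (reindex_onto (edge_in_faces i) h) => [|p ip]; last first.
  case: (edge_in_facesP p) => a [b [ab pE]]; subst p.
  rewrite mem_edge_in_faces // negb_and !negbK in ip.
  case/orP: ip => /eqP ?; subst i; first by rewrite hK // eq_sym.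
  by rewrite (edge_in_facesC a) hK.
apply: eq_bigl => j; have [->|ji] := eqVneq j i.
  by rewrite (negbTE (hi _)) andbF.
by rewrite hK // eqxx mem_edge_in_faces 1?eq_sym // eqxx.
Qed.

(** * Numberings of the vertices of a tetrahedron *)

(** [b] is the parity of the numbering relative to the orientation: pictures
    of a tetrahedron use even numberings, and gluings reverse the parity. *)
Definition numbering (b : bool) (n s w e : 'I_4) : Prop :=
  exists2 sigma : 'S_4, odd_perm sigma = b &
  [/\ sigma (inord 0) = n, sigma (inord 1) = s,
      sigma (inord 2) = w & sigma (inord 3) = e].

Lemma uniq_inord4 : uniq [:: inord 0; inord 1; inord 2; inord 3 : 'I_4].
Proof. by rewrite /= !inE -!val_eqE /= !inordK. Qed.

Lemma numbering_uniq b n s w e : numbering b n s w e -> uniq [:: n; s; w; e].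
Proof.
case=> sigma _ [<- <- <- <-].
rewrite -[[:: _; _; _; _]]/(map sigma [:: inord 0; inord 1; inord 2; inord 3]).
by rewrite map_inj_uniq ?uniq_inord4 //; exact: perm_inj.
Qed.

Lemma numbering_swap01 b n s w e :
  numbering b n s w e -> numbering (~~ b) s n w e.
Proof.
have [[[[i01 i02 i03] [i10 i12 i13]] [i20 i21 i23]] [i30 i31 i32]] :=
  uniq4_neq uniq_inord4.
case=> sigma sb [sn ss sw se]; exists (tperm (inord 0) (inord 1) * sigma)%g.
  by rewrite odd_mul_tperm i01 sb.
by rewrite !permM tpermL tpermR !tpermD ?i02 ?i12 ?i03 ?i13.
Qed.

Lemma numbering_swap12 b n s w e :
  numbering b n s w e -> numbering (~~ b) n w s e.
Proof.
have [[[[i01 i02 i03] [i10 i12 i13]] [i20 i21 i23]] [i30 i31 i32]] :=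
  uniq4_neq uniq_inord4.
case=> sigma sb [sn ss sw se]; exists (tperm (inord 1) (inord 2) * sigma)%g.
  by rewrite odd_mul_tperm i12 sb.
by rewrite !permM tpermL tpermR !tpermD ?i10 ?i20 ?i13 ?i23.
Qed.

Lemma numbering_swap23 b n s w e :
  numbering b n s w e -> numbering (~~ b) n s e w.
Proof.
have [[[[i01 i02 i03] [i10 i12 i13]] [i20 i21 i23]] [i30 i31 i32]] :=
  uniq4_neq uniq_inord4.
case=> sigma sb [sn ss sw se]; exists (tperm (inord 2) (inord 3) * sigma)%g.
  by rewrite odd_mul_tperm i23 sb.
by rewrite !permM tpermL tpermR !tpermD ?i20 ?i30 ?i21 ?i31.
Qed.

Lemma numbering_image b n s w e (tau : 'S_4) : odd_perm tau ->
  numbering b n s w e -> numbering (~~ b) (tau n) (tau s) (tau w) (tau e).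
Proof.
move=> otau [sigma sb [<- <- <- <-]]; exists (sigma * tau)%g; last by rewrite !permM.
by rewrite odd_permM otau sb addbT.
Qed.

Lemma uniq_numbering n s w e : uniq [:: n; s; w; e] -> exists b, numbering b n s w e.
Proof.
move=> u; pose f (i : 'I_4) := nth n [:: n; s; w; e] i.
have f_inj : injective f.
  by move=> i j /eqP; rewrite nth_uniq ?ltn_ord // => /eqP /val_inj.
by exists (odd_perm (perm f_inj)), (perm f_inj); rewrite // !permE /f !inordK.
Qed.

Section VeeringTriangulation.
Context (V : veering_triangulation).

Notation F := (triangle (@glue V)).
Notation mate := (mate (@glue V)).
Notation triangle_of := (triangle_of (@glue V)).
Notation edge_of := (edge_of (@glue V)).

Implicit Types (x y : side V) (t : V) (i j : 'I_4).

(** * Triangles as pairs of mated sides *)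

Lemma glue_back t i :
  glue (glue t i).1 ((glue t i).2 i) = (t, (glue t i).2^-1%g).
Proof. by have := glueK (vt_triangulation V) t i; case: (glue t i). Qed.

Lemma mateK : involutive mate.
Proof. by case=> t i; rewrite /Defs.mate /= glue_back /= permK. Qed.

Lemma mate_rel_sym : symmetric [rel x y | mate x == y].
Proof. by move=> x y /=; rewrite (can2_eq mateK mateK) eq_sym. Qed.

Lemma triangle_of_mate x : triangle_of (mate x) = triangle_of x.
Proof.
by apply/esym/class_of_eq; [exact: mate_rel_sym | rewrite /= eqxx].
Qed.

Lemma mem_triangle_of x y :
  (y \in members (triangle_of x)) = (y == x) || (y == mate x).
Proof.
rewrite mem_class_of; apply/idP/orP => [|[] /eqP ->]; last 2 first.
- exact: connect0.
- by apply: connect1 => /=.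
move: y; have Pr (a b : side V) : (a == x) || (a == mate x) ->
    [rel x y | mate x == y] a b -> (b == x) || (b == mate x).
  by move=> /orP[] /eqP -> /eqP <-; rewrite ?mateK eqxx ?orbT.
move=> y /(connect_sub_inv Pr) xy; apply/orP; apply: xy.
by rewrite eqxx.
Qed.

Lemma triangle_of_eq x y :
  triangle_of x = triangle_of y -> y = x \/ y = mate x.
Proof.
move=> e; have : y \in members (triangle_of x).
  by rewrite e mem_triangle_of eqxx.
by rewrite mem_triangle_of => /orP[] /eqP; [left | right].
Qed.

Lemma big_triangle (M : nmodType) x (G : side V -> M) :
  \sum_(y in members (triangle_of x)) G y = G x + G (mate x).
Proof.
rewrite (bigD1 x) ?mem_triangle_of ?eqxx //=; congr (_ + _).
rewrite (big_pred1 (mate x)) // => y.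
rewrite mem_triangle_of /=; have [->|_] := eqVneq y x; last by rewrite andbT.
by rewrite /= eq_sym (negbTE (glue_neq (vt_triangulation V) x)).
Qed.

(** * Spanning trees *)

Section Branching.
Context (B : {pred F}) (B_branch : forall x, B (triangle_of x) ->
  exists y, [/\ y.1 = x.1, y != x & B (triangle_of y)]).

Let next x := odflt x
  [pick y : side V | [&& y.1 == (mate x).1, y != mate x & B (triangle_of y)]].

Let nextP x : B (triangle_of x) ->
  [/\ (next x).1 = (mate x).1, next x != mate x & B (triangle_of (next x))].
Proof.
move=> Bx; rewrite /next; case: pickP => [y /and3P[/eqP -> -> ->] //|no].
have := B_branch (x := mate x); rewrite triangle_of_mate => /(_ Bx)[y [y1 yx By]].
by have := no y; rewrite y1 yx By eqxx.
Qed.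

Let iterB x n : B (triangle_of x) -> B (triangle_of (iter n next x)).
Proof. by move=> Bx; elim: n => //= n /nextP[]. Qed.

(** A nonbacktracking walk through the triangles of [B] never gets stuck; the
    stretch between the first return to a tetrahedron and the previous visit
    there is a cycle. *)
Lemma branching_has_cycle x0 : B (triangle_of x0) ->
  exists2 c, graph_cycle c & all B [seq triangle_of x | x <- c].
Proof.
move=> Bx0; pose g k := iter k next x0.
pose P b := [exists a : 'I_b, (g a).1 == (g b).1].
have exP : exists b, P b.
  have /injectivePn[i [j ij eij]] : ~~ injectiveb (fun k : 'I_#|V|.+1 => (g k).1).
    by apply/negP => /injectiveP /leq_card; rewrite card_ord ltnn.
  have [ltij|ltji|/ord_inj/eqP] := ltngtP i j; last by rewrite (negbTE ij).
    by exists j; apply/existsP; exists (Ordinal ltij); rewrite /= eij.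
  by exists i; apply/existsP; exists (Ordinal ltji); rewrite /= eij.
have [b /existsP[[a ab] /= /eqP gab] minb] := ex_minnP exP.
pose z := g a; pose n := (b - a)%N.
have Bz : B (triangle_of z) by exact: iterB.
have gz k : g (a + k)%N = iter k next z by rewrite /g addnC iterD.
have n_gt0 : (0 < n)%N by rewrite subn_gt0.
have zn : (iter n next z).1 = z.1 by rewrite -gz subnKC ?gab // ltnW.
have ltinj (i j : nat) : (i < j < n)%N -> (iter i next z).1 <> (iter j next z).1.
  case/andP=> ij jn e; have : P (a + j)%N.
    have aij : (a + i < a + j)%N by rewrite ltn_add2l.
    by apply/existsP; exists (Ordinal aij); rewrite /= !gz e.
  by move/minb; rewrite leqNgt -ltn_subRL jn.
pose c := traject next z n.
have nth_c (i : nat) : (i < n)%N -> nth z c i = iter i next z.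
  by move=> ilt; rewrite /c nth_traject.
have uniq_c (W : eqType) (h : side V -> W) :
    (forall i j : nat, (i < j < n)%N -> h (iter i next z) <> h (iter j next z)) ->
  uniq [seq h x | x <- c].
  move=> hh; apply/(uniqP (h z)) => i j.
  rewrite !inE !size_map size_traject => ilt jlt.
  rewrite !(nth_map z) ?size_traject // !nth_c // => e.
  have [lt|lt|//] := ltngtP i j; first by case: (hh i j); rewrite ?lt.
  by case: (hh j i); rewrite ?lt.
exists c; last first.
  apply/allP => f /mapP[x /trajectP[k _ ->] ->]; exact: iterB.
apply/and4P; split.
- by rewrite /c; case: (n) n_gt0.
- have pathB m w : B (triangle_of w) ->
      path [rel x y : side V | (mate x).1 == y.1] w (traject next (next w) m).
    elim: m w => //= m IH w Bw; have [w1 _ Bw'] := nextP Bw.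
    by rewrite w1 eqxx IH.
  rewrite /c; move: zn n_gt0; case: (n) => // m /= zn _.
  rewrite rcons_path pathB //= last_traject.
  by have [e _ _] := nextP (iterB m Bz); apply/eqP; rewrite -zn; apply/esym; exact: e.
- exact: uniq_c.
- apply: uniq_c => i j /andP[ij jn] /triangle_of_eq[e|e].
    by apply: (ltinj i j); rewrite ?ij // e.
  have [e1 neq _] := nextP (iterB i Bz).
  move: ij; rewrite leq_eqVlt => /orP[/eqP ji|ij].
    by move: neq; rewrite -e -ji /= eqxx.
  by case: (ltinj i.+1 j); rewrite ?ij ?jn //= e1 -e.
Qed.

End Branching.

(** A nonempty part of a tree has a leaf: a tetrahedron with exactly one side
    in this part. If the tree faces violating [P] had no leaf, each walk
    through them could be continued, and they would contain a cycle. *)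
Lemma tree_face_induction (Y : {set F}) (P : F -> Prop) :
  spanning_tree Y ->
  (forall f, f \notin Y -> P f) ->
  (forall x, (forall i, i != x.2 -> P (triangle_of (x.1, i))) ->
     P (triangle_of x)) ->
  forall f, P f.
Proof.
move=> treeY offY Pstep f; apply: contrapT => nPf.
pose B : {pred F} := fun f => `[< ~ P f >].
have BY g : B g -> g \in Y.
  by move=> /asboolP nPg; apply: contrapT => /negP /offY.
have [x fE] := class_of_surj f.
have [||c cyc allB] := @branching_has_cycle B _ x.
- move=> y /asboolP nPy; apply: contrapT => noz; apply: nPy; apply: Pstep => i iy.
  apply: contrapT => nP; apply: noz; exists (y.1, i); split => //.
    by apply: contraNneq iy => <-.
  by apply/asboolP.
- by apply/asboolP; rewrite /Defs.triangle_of -fE.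
by have /negP[] := tree_acyclic treeY cyc; apply: sub_all allB.
Qed.

(** * Turning around an edge *)

Notation ZH := (grpring (H V)).
Notation turn := (@turn V).

Implicit Types z : V * ('I_4 * 'I_4).

(** A state [(t, (i, j))] crosses [t] from its face [j] to its face [i];
    reversing it crosses [t] the other way around the same edge. *)
Definition reverse z : V * ('I_4 * 'I_4) := (z.1, (z.2.2, z.2.1)).

Definition axis z : V * edge_in_tet := (z.1, edge_in_faces z.2.1 z.2.2).

Lemma reverseK : involutive reverse. Proof. by case=> t []. Qed.

Lemma axis_reverse z : axis (reverse z) = axis z.
Proof. by rewrite /axis /= edge_in_facesC. Qed.

Lemma axisP (x : V * edge_in_tet) : exists2 z, z.2.1 != z.2.2 & x = axis z.
Proof.
case: x => t p; have [i [j [ij ->]]] := edge_in_facesP p.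
by exists (t, (i, j)).
Qed.

Lemma turn_reverse z : turn (reverse (turn z)) = reverse z.
Proof. by rewrite /turn /reverse /= !glue_back /= !permK. Qed.

Lemma turn_inj : injective turn.
Proof.
apply: (can_inj (g := fun z => reverse (turn (reverse z)))) => z.
by rewrite turn_reverse reverseK.
Qed.

Lemma turn_back z : turn (reverse (turn (reverse z))) = z.
Proof. by rewrite turn_reverse reverseK. Qed.

Lemma turn_neq z : ((turn z).2.1 != (turn z).2.2) = (z.2.1 != z.2.2).
Proof. by rewrite /= (inj_eq perm_inj) eq_sym. Qed.

Lemma iter_turn_neq k z :
  ((iter k turn z).2.1 != (iter k turn z).2.2) = (z.2.1 != z.2.2).
Proof. by elim: k => //= k <-; rewrite -turn_neq. Qed.

Lemma iter_turn_reverse k z :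
  iter k turn (reverse (iter k turn z)) = reverse z.
Proof. by elim: k => //= k IH; rewrite -iterS iterSr turn_reverse. Qed.

(** An edge is never identified with itself by a half-turn about a transverse
    axis: halfway along a walk from [z] to its reverse, either a tetrahedron
    would be crossed both ways at once, or a face would be glued to itself. *)
Lemma reverse_notin_orbit z :
  z.2.1 != z.2.2 -> ~~ fconnect turn z (reverse z).
Proof.
move=> zij; apply/negP => /iter_findex; set k := findex _ _ _ => e.
have iter_inj m : injective (iter m turn).
  by elim: m => // m IH a b /= /turn_inj /IH.
have := odd_double_half k; rewrite -addnn; case: (odd k) => /= kE; last first.
  move: e; rewrite -kE add0n iterD -(iter_turn_reverse k./2 z) => /iter_inj e.
  have := iter_turn_neq k./2 z.
  by rewrite {1}(congr1 (fun w => w.2.1) e) /= eqxx zij.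
move: e; rewrite -kE addnCA iterD -(iter_turn_reverse k./2 z) => /iter_inj /=.
set w := iter _ _ _ => -[e1 e2 e3].
have /negP[] := glue_neq (vt_triangulation V) (w.1, w.2.1); apply/eqP.
by rewrite /Defs.mate /= e1 e3.
Qed.

Lemma carry_edge_turn z : z.2.1 != z.2.2 ->
  carry_edge (@glue V) z.2.1 (axis z) (axis (turn z)).
Proof.
move=> zij; rewrite /carry_edge /= mem_edge_in_faces // eqxx /=.
by rewrite imset_edge_in_faces // edge_in_facesC !eqxx.
Qed.

Lemma carry_edge_inj i (x y y' : V * edge_in_tet) :
  carry_edge (@glue V) i x y -> carry_edge (@glue V) i x y' -> y = y'.
Proof.
case/and3P=> _ /eqP e1 /eqP e2 /and3P[_ /eqP e1' /eqP e2'].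
case: y y' e1 e2 e1' e2' => a b [c d] /= -> e -> e'; congr (_, _).
by apply: val_inj; rewrite /= e e'.
Qed.

(** An edge of a tetrahedron lies in two of its faces, so carrying it to a
    neighbour amounts to turning around it in one direction or the other. *)
Lemma carry_edgeP i z (y : V * edge_in_tet) : z.2.1 != z.2.2 ->
  carry_edge (@glue V) i (axis z) y ->
  exists2 w, w = z \/ w = reverse z & w.2.1 = i /\ y = axis (turn w).
Proof.
move=> zij zy.
have : (i == z.2.1) || (i == z.2.2).
  have := zy => /andP[+ _]; rewrite mem_edge_in_faces //.
  by rewrite negb_and !negbK.
case/orP=> /eqP ei; subst i.
  exists z; first by left.
  by split=> //; apply: carry_edge_inj zy (carry_edge_turn zij).
exists (reverse z); first by right.
split=> //; apply: carry_edge_inj zy _.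
by rewrite -axis_reverse; apply: (@carry_edge_turn (reverse z)); rewrite /= eq_sym.
Qed.

Lemma carry_edge_back i (x y : V * edge_in_tet) :
  carry_edge (@glue V) i x y ->
  carry_edge (@glue V) ((glue x.1 i).2 i) y x.
Proof.
case: (axisP x) => z zij -> /(carry_edgeP zij)[w wz [<- ->]].
have wij : w.2.1 != w.2.2 by case: wz => ->; rewrite //= eq_sym.
have -> : axis z = axis w by case: wz => ->; rewrite ?axis_reverse.
have := @carry_edge_turn (reverse (turn w)).
rewrite turn_reverse !axis_reverse; apply.
by rewrite eq_sym turn_neq.
Qed.

Let carry_rel := [rel x y : V * edge_in_tet | [exists i, carry_edge (@glue V) i x y]].

Lemma carry_rel_sym : symmetric carry_rel.
Proof.
by move=> x y; apply/existsP/existsP => -[i /carry_edge_back ?]; eexists; eassumption.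
Qed.

Lemma edge_of_carry i (x y : V * edge_in_tet) :
  carry_edge (@glue V) i x y -> edge_of x = edge_of y.
Proof.
by move=> xy; apply: class_of_eq carry_rel_sym _; apply/existsP; exists i.
Qed.

Lemma mem_edge_of z (x : V * edge_in_tet) : z.2.1 != z.2.2 ->
  (x \in members (edge_of (axis z))) = (x \in [seq axis w | w <- orbit turn z]).
Proof.
move=> zij; rewrite mem_class_of; apply/idP/mapP => [|[w]]; last first.
  rewrite -fconnect_orbit => /iter_findex <- ->.
  elim: (findex _ _ _) => [|k IH]; first exact: connect0.
  apply: connect_trans IH _; apply: connect1; apply/existsP.
  by eexists; apply: carry_edge_turn; rewrite iter_turn_neq.
pose P (x : V * edge_in_tet) := exists2 w, w \in orbit turn z & x = axis w.
apply: (@connect_sub_inv _ _ P); last by exists z; rewrite // -fconnect_orbit connect0.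
move=> a b [w zw ->] /existsP[i].
have wij : w.2.1 != w.2.2.
  by move: zw; rewrite -fconnect_orbit => /iter_findex <-; rewrite iter_turn_neq.
case/(carry_edgeP wij) => w' [] -> [_ ->].
  exists (turn w) => //; move: zw; rewrite -!fconnect_orbit => zw.
  exact: connect_trans zw (fconnect1 _ _).
exists (reverse (turn (reverse w))); last by rewrite axis_reverse.
move: zw; rewrite -!fconnect_orbit => zw; apply: connect_trans zw _.
by rewrite (fconnect_sym turn_inj) -{2}(turn_back w) fconnect1.
Qed.

(** A tetrahedron may meet an edge several times, but a walk around the edge
    crosses each of these embeddings only once. *)
Lemma axis_inj_orbit z : z.2.1 != z.2.2 -> {in orbit turn z &, injective axis}.
Proof.
move=> zij w w'; rewrite -!fconnect_orbit => zw zw' e.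
have wij : w.2.1 != w.2.2 by rewrite -(iter_findex zw) iter_turn_neq.
have wij' : w'.2.1 != w'.2.2 by rewrite -(iter_findex zw') iter_turn_neq.
have ww' : fconnect turn w w'.
  by apply: connect_trans zw'; rewrite (fconnect_sym turn_inj).
case: e => e1 /(edge_in_faces_inj wij wij')[] e2.
  by apply/eqP; rewrite -pair_eqE /= e1 -pair_eqE /=; case: e2 => -> ->; rewrite !eqxx.
have /negP[] := reverse_notin_orbit wij; congr (is_true (fconnect _ _ _)): ww'.
by case: w' e1 e2 {zw' wij'} => a [b c]; rewrite /reverse /= => -> [-> ->].
Qed.

Lemma big_orbit_turn (M : nmodType) z (G : V * ('I_4 * 'I_4) -> M) :
  \sum_(w <- orbit turn z) G (turn w) = \sum_(w <- orbit turn z) G w.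
Proof.
rewrite -(big_map turn predT G) /=; apply: perm_big.
have mapt n w : [seq turn w | w <- traject turn w n] = traject turn (turn w) n.
  by elim: n w => //= n IH w; rewrite IH.
rewrite /orbit mapt -(perm_cons z) -trajectS trajectSr.
by rewrite (iter_order turn_inj) perm_rcons.
Qed.

(** * Every edge is the top diagonal of exactly one tetrahedron *)

Lemma card_down t : #|[set i | ~~ up (t, i)]| = 2.
Proof.
have -> : [set i | ~~ up (t, i)] = ~: [set i | up (t, i)].
  by apply/setP => i; rewrite !inE.
by rewrite cardsCs setCK card_ord (two_top_faces (vt_taut V)).
Qed.

Lemma top_diagE t : top_diag (@up V) t = ~: [set i | up (t, i)].
Proof.
apply/setP => i; rewrite !inE; apply/bigcapP/idP => [h|ui j uj].
  by apply/negP => /h; rewrite !inE eqxx.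
by rewrite !inE; apply: contraNneq ui => ->.
Qed.

Lemma bot_diagE t : bot_diag (@up V) t = [set i | up (t, i)].
Proof.
apply/setP => i; rewrite !inE; apply/bigcapP/idP => [h|ui j uj].
  by apply: contraT => /h; rewrite !inE eqxx.
by rewrite !inE; apply: contraNneq uj => <-.
Qed.

Lemma eq_top_diag t i j : i != j ->
  (sval (edge_in_faces i j) == top_diag (@up V) t) = up (t, i) && up (t, j).
Proof.
move=> ij; rewrite val_edge_in_faces // top_diagE setC2_eq ?inE //.
exact: two_top_faces (vt_taut V) t.
Qed.

Lemma eq_bot_diag t i j : i != j ->
  (sval (edge_in_faces i j) == bot_diag (@up V) t) = ~~ up (t, i) && ~~ up (t, j).
Proof.
move=> ij; rewrite val_edge_in_faces // bot_diagE.
have -> : [set i | up (t, i)] = ~: [set i | ~~ up (t, i)].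
  by apply/setP => k; rewrite !inE negbK.
by rewrite setC2_eq ?inE //; exact: card_down.
Qed.

Let leaving z := up (z.1, z.2.1).
Let entering z := up (z.1, z.2.2).

Let entering_turn z : entering (turn z) = ~~ leaving z.
Proof. exact: (up_mate (vt_taut V) (z.1, z.2.1)). Qed.

Let angle_axis z : z.2.1 != z.2.2 ->
  angle (@up V) (axis z) =
  ((leaving z && entering z) + (~~ leaving z && ~~ entering z))%N.
Proof.
move=> zij; rewrite /angle eq_top_diag // eq_bot_diag // -/(leaving z) -/(entering z).
by case: leaving; case: entering.
Qed.

Lemma orbit_neq z w : z.2.1 != z.2.2 -> w \in orbit turn z -> w.2.1 != w.2.2.
Proof. by rewrite -fconnect_orbit => zij /iter_findex <-; rewrite iter_turn_neq. Qed.

(** Around an edge the coorientation of the faces crossed changes sense once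
    in each tetrahedron having the edge as a diagonal, in opposite ways for
    the top and the bottom ones; so these are equally many, and the angle sum
    leaves one of each. *)
Lemma unique_top_diag z : z.2.1 != z.2.2 ->
  exists2 w, w \in orbit turn z &
  forall w', w' \in orbit turn z ->
    (sval (axis w').2 == top_diag (@up V) w'.1) = (w' == w).
Proof.
move=> zij; set s := orbit turn z.
pose ntop := (\sum_(w <- s) (leaving w && entering w))%N.
pose nbot := (\sum_(w <- s) (~~ leaving w && ~~ entering w))%N.
have sum_angle : (ntop + nbot = 2)%N.
  rewrite -(angle_sum (vt_taut V) (edge_of (axis z))) -big_split /=.
  rewrite -[RHS]big_filter [RHS](perm_big [seq axis w | w <- s]) /=; last first.
    apply: uniq_perm => [||x].
    - by rewrite filter_uniq ?index_enum_uniq.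
    - by rewrite map_inj_in_uniq ?orbit_uniq //; exact: axis_inj_orbit.
    - by rewrite mem_filter mem_index_enum andbT mem_edge_of.
  rewrite big_map big_seq [RHS]big_seq; apply: eq_bigr => w /(orbit_neq zij) wij.
  by rewrite angle_axis.
have ent_lea : (\sum_(w <- s) entering w + \sum_(w <- s) leaving w = size s)%N.
  rewrite -(big_orbit_turn z (fun w => entering w : nat)) -big_split /=.
  rewrite -sum1_size; apply: eq_bigr => w _.
  by rewrite entering_turn; case: leaving.
have top_bot : ntop = nbot.
  apply/eqP; rewrite -(eqn_add2l (size s)) -{2}ent_lea -sum1_size -!big_split /=.
  by apply/eqP/eq_bigr => w _; case: leaving; case: entering.
have /eqP : ntop = 1%N.
  by apply: double_inj; rewrite -addnn {2}top_bot sum_angle.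
have -> : ntop = size [seq w <- s | leaving w && entering w].
  by rewrite size_filter -sum1_count big_mkcond /=; apply: eq_bigr => w _; case: ifP.
case E : [seq w <- s | leaving w && entering w] => [|w []] // _.
have mem_w w' : (w' \in s) && (leaving w' && entering w') = (w' == w).
  by rewrite andbC -(mem_filter (fun w => leaving w && entering w)) E inE.
exists w => [|w' sw'].
  by have := mem_w w; rewrite eqxx => /andP[].
rewrite -mem_w sw' eq_top_diag //; exact: orbit_neq sw'.
Qed.

(** * The free abelian cover along an edge *)

Let step z : chain1 V :=
  [ffun f => if f == triangle_of (z.1, z.2.1)
             then (if up (z.1, z.2.1) then 1 else -1) else 0].

Lemma loop_aroundE z f : loop_around z f = \sum_(w <- orbit turn z) step w f.
Proof. by rewrite /loop_around sum_ffunE. Qed.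

(** The loop enters each tetrahedron as often as it leaves it. *)
Lemma loop_around_cycle z : loop_around z \in @cycle_pred V.
Proof.
rewrite unfold_in; apply/eqP/ffunP => t; rewrite !ffunE.
under eq_bigr do under eq_bigr do rewrite loop_aroundE mulr_sumr.
under eq_bigr do rewrite exchange_big.
rewrite exchange_big /=.
transitivity (\sum_(w <- orbit turn z) (((turn w).1 == t)%:R - (w.1 == t)%:R : int)).
  apply: eq_bigr => w _; set e := (w.1, w.2.1).
  rewrite (bigD1 (triangle_of e)) //= [X in _ + X]big1 => [|f fe]; last first.
    by rewrite big1 // => x _; rewrite ffunE (negbTE fe) mulr0.
  rewrite addr0 big_mkcondr big_triangle !ffunE eqxx /= (up_mate (vt_taut V)).
  rewrite -/e -[glue w.1 w.2.1]/(glue e.1 e.2) addrC.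
  by case: (up e); case: eqP => _; case: eqP => _.
by rewrite sumrB (big_orbit_turn z (fun w => (w.1 == t)%:R : int)) subrr.
Qed.

Lemma homology_class_loop z : z.2.1 != z.2.2 ->
  homology_class (Cycle1 (loop_around_cycle z)) = 0.
Proof.
move=> zij; rewrite /homology_class.
set c := Cycle1 _; suff -> : (\pi_(Quotient.quot (boundaries V)) c = 0)%qT.
  by rewrite raddf0.
rewrite -[RHS](raddf0 (\pi_(Quotient.quot (boundaries V)))%qT).
apply/eqP; rewrite -Quotient.idealrBE subr0 unfold_in; apply/asboolP.
exists (fun w => (w == z)%:R); rewrite (bigD1 z) //= eqxx mulr1z big1 ?addr0 //.
by move=> w /andP[_ /negbTE ->]; rewrite mulr0z.
Qed.

Section Cover.
Context (phi : F -> H V) (liftphi : is_lift phi).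

(** The displacement in the cover: [k] turns lead from [h.t] to a tetrahedron
    with coefficient [h + shift z k]. *)
Definition shift z k : H V :=
  \sum_(w <- traject turn z k) crossing phi (w.1, w.2.1).

Lemma shiftD z k l : shift z (k + l) = shift z k + shift (iter k turn z) l.
Proof. by rewrite /shift trajectD big_cat. Qed.

Lemma shiftS z k : shift z k.+1 =
  shift z k + crossing phi ((iter k turn z).1, (iter k turn z).2.1).
Proof. by rewrite -addn1 shiftD /shift /= big_seq1. Qed.

(** A full turn around an edge bounds a dual 2-cell, so it lifts to a loop. *)
Lemma shift_order z : z.2.1 != z.2.2 -> shift z (order turn z) = 0.
Proof.
move=> zij; rewrite -(homology_class_loop zij) -liftphi /=.
under eq_bigr do rewrite loop_aroundE mulrz_sumr.
rewrite exchange_big; apply: eq_bigr => w _ /=.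
rewrite (bigD1 (triangle_of (w.1, w.2.1))) //= big1 => [|f fe].
  by rewrite addr0 ffunE eqxx /crossing; case: ifP => _; rewrite ?mulr1z ?mulrN1z.
by rewrite ffunE (negbTE fe) mulr0z.
Qed.

(** Hence the displacement depends only on the endpoint of the walk. *)
Lemma shift_mod z k : z.2.1 != z.2.2 ->
  shift z k = shift z (findex turn z (iter k turn z)).
Proof.
move=> zij; have : (k %% order turn z < order turn z)%N by rewrite ltn_mod order_gt0.
rewrite {2 3}(divn_eq k (order turn z)); move: (k %% _)%N (k %/ _)%N => r q rlt.
elim: q => [|q IH]; first by rewrite mul0n add0n findex_iter.
rewrite mulSn -addnA (shiftD z (order turn z)) (shift_order zij) add0r.
rewrite (iter_order turn_inj z) IH.
by rewrite (addnC (order turn z)) [in RHS]iterD (iter_order turn_inj).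
Qed.

Lemma crossing_mate x : crossing phi (mate x) = - crossing phi x.
Proof.
rewrite /crossing (up_mate (vt_taut V)) triangle_of_mate.
by case: up; rewrite ?opprK.
Qed.

Lemma carry_lifted_edge_back (x y : H V * (V * edge_in_tet)) :
  carry_lifted_edge phi x y -> carry_lifted_edge phi y x.
Proof.
case: x y => h x [h' y] [i /= xy ->]; exists ((glue x.1 i).2 i).
  exact: carry_edge_back xy.
case/and3P: xy => _ /eqP -> _.
by rewrite -[(_, (glue _ _).2 _)]/(mate (x.1, i)) crossing_mate addrK.
Qed.

Lemma same_lifted_edge_shift z h k :
  z.2.1 != z.2.2 ->
  same_lifted_edge phi (h, axis z) (h + shift z k, axis (iter k turn z)).
Proof.
move=> zij; elim: k => [|k IH].
  by rewrite /shift big_nil addr0; exact: rst_refl.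
apply: rst_trans IH _; apply: rst_step; exists (iter k turn z).2.1.
  by apply: carry_edge_turn; rewrite iter_turn_neq.
by rewrite /= shiftS addrA.
Qed.

(** The walks in one direction reach all the representatives of a lifted edge:
    a turn in the other direction can be replaced by the rest of the full turn,
    because the latter lifts to a loop. *)
Lemma same_lifted_edgeP z h (x : H V * (V * edge_in_tet)) :
  z.2.1 != z.2.2 -> same_lifted_edge phi (h, axis z) x ->
  exists k, x = (h + shift z k, axis (iter k turn z)).
Proof.
move=> zij; pose P (y : H V * (V * edge_in_tet)) :=
  exists k, y = (h + shift z k, axis (iter k turn z)).
have Pstep a b : carry_lifted_edge phi a b -> P a -> P b.
  case: a b => ha a [hb b] [i /= ab ->] [k [-> ak]]; subst a.
  pose N := order turn z; pose w := iter k turn z.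
  have wij : w.2.1 != w.2.2 by rewrite iter_turn_neq.
  case/(carry_edgeP wij): ab => w' [] ->{w'} [<- ->].
    by exists k.+1; rewrite shiftS addrA.
  have [m mE] : exists m, (k + N)%N = m.+1.
    by exists (k + N).-1; rewrite prednK // addn_gt0 order_gt0 orbT.
  have e : iter m turn z = reverse (turn (reverse w)).
    apply: turn_inj.
    by rewrite -iterS -mE turn_back iterD (iter_order turn_inj).
  exists m; rewrite e axis_reverse; congr (_, _).
  have -> : shift z k = shift z (k + N).
    by rewrite addnC shiftD shift_order // add0r (iter_order turn_inj).
  rewrite mE shiftS e -[(_, _)]/(mate (w.1, w.2.2)) crossing_mate.
  by rewrite -!addrA addNr addr0.
have Pstep' a b : carry_lifted_edge phi a b -> (P a <-> P b).
  by move=> ab; split; apply: Pstep => //; exact: carry_lifted_edge_back.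
have Pall a b : same_lifted_edge phi a b -> (P a <-> P b).
  elim=> {a b} [a b /Pstep' //|a //|a b _ [? ?]|a b c _ [? ?] _ [? ?]]; split; tauto.
move=> /Pall[+ _]; apply; exists 0%N.
by rewrite /shift big_nil addr0.
Qed.

Lemma same_lifted_edge_translate g (x y : H V * (V * edge_in_tet)) :
  same_lifted_edge phi x y ->
  same_lifted_edge phi (g + x.1, x.2) (g + y.1, y.2).
Proof.
elim=> {x y} [x y [i xy ->]|x|x y _ IH|x y z _ IH _ IH'].
- by apply: rst_step; exists i => //=; rewrite addrA.
- exact: rst_refl.
- exact: rst_sym.
- exact: rst_trans IH IH'.
Qed.

Lemma edge_coef_unique (x : V * edge_in_tet) (h h' : H V) (y y' : V * edge_in_tet) :
  sval y.2 = top_diag (@up V) y.1 -> same_lifted_edge phi (h, y) (0, x) ->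
  sval y'.2 = top_diag (@up V) y'.1 -> same_lifted_edge phi (h', y') (0, x) ->
  h = h'.
Proof.
case: (axisP x) => z zij -> ytop yx ytop' yx'.
have [k [hE yE]] := same_lifted_edgeP zij (rst_sym _ _ _ _ yx).
have [k' [hE' yE']] := same_lifted_edgeP zij (rst_sym _ _ _ _ yx').
have [w _ wP] := unique_top_diag zij.
have in_orb m : iter m turn z \in orbit turn z.
  by rewrite -fconnect_orbit fconnect_iter.
have e : iter k turn z = w.
  by apply/eqP; rewrite -wP // -yE; apply/eqP; rewrite ytop yE.
have e' : iter k' turn z = w.
  by apply/eqP; rewrite -wP // -yE'; apply/eqP; rewrite ytop' yE'.
by rewrite hE hE' (shift_mod _ zij) e -e' -(shift_mod _ zij).
Qed.

Lemma edge_coefP (x : V * edge_in_tet) :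
  exists2 y, sval y.2 = top_diag (@up V) y.1
           & same_lifted_edge phi (edge_coef phi x, y) (0, x).
Proof.
rewrite /edge_coef; case: xgetP => [h _ //|none].
exfalso; move: none.
case: (axisP x) => z zij ->.
have [w zw wP] := unique_top_diag zij.
move: (zw); rewrite -fconnect_orbit => /iter_findex wE.
move/(_ (shift z (findex turn z w))); apply; exists (axis w).
  by apply/eqP; rewrite wP.
apply: rst_sym; rewrite -{2}wE -[shift z _]add0r.
exact: same_lifted_edge_shift.
Qed.

(** Both sides are the coefficient of the one tetrahedron below the edge, read
    from the lifts of two neighbours; existence and uniqueness of that
    coefficient make the comparison possible. *)
Lemma edge_coef_carry i (x y : V * edge_in_tet) :
  carry_edge (@glue V) i x y ->
  edge_coef phi x = crossing phi (x.1, i) + edge_coef phi y.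
Proof.
move=> xy; have [x' x'top xx'] := edge_coefP x; have [y' y'top yy'] := edge_coefP y.
apply: (edge_coef_unique x'top xx' y'top).
apply: rst_trans (same_lifted_edge_translate (crossing phi (x.1, i)) yy') _.
apply: rst_sym; apply: rst_step; exists i => //=.
by rewrite addr0 add0r.
Qed.

Lemma lifted_edge_carry i (x y : V * edge_in_tet) :
  carry_edge (@glue V) i x y ->
  lifted_edge phi x = gr_elt (crossing phi (x.1, i)) *: lifted_edge phi y.
Proof.
move=> xy; rewrite /lifted_edge (edge_of_carry xy) (edge_coef_carry xy) gr_eltD.
exact: (@freemod_delta ZH _ (edge_of y) (gr_elt (crossing phi (x.1, i)))
  (gr_elt (edge_coef phi y))).
Qed.

End Cover.

(** * The relation between the four faces of a tetrahedron *)

(** The picture of [t] seen from above, with [n] and [s] the ends of the top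
    diagonal and [w] and [e] those of the bottom one. Faces being named after
    the opposite vertices, [w] and [e] are the top faces. *)
Definition drawn t (n s w e : 'I_4) : Prop :=
  [/\ numbering false n s w e, ~~ up (t, n), ~~ up (t, s), up (t, w) & up (t, e)].

Lemma drawn_exists t : exists n s w e, drawn t n s w e.
Proof.
have /eqP/cards2P[w [e [we upE]]] := two_top_faces (vt_taut V) t.
have /eqP/cards2P[n [s [ns downE]]] := card_down t.
have /setP upP := upE; have /setP downP := downE.
have up_w : up (t, w) by have := upP w; rewrite !inE eqxx.
have up_e : up (t, e) by have := upP e; rewrite !inE eqxx orbT.
have dn_n : ~~ up (t, n) by have := downP n; rewrite !inE eqxx.
have dn_s : ~~ up (t, s) by have := downP s; rewrite !inE eqxx orbT.
have neq i j : ~~ up (t, i) -> up (t, j) -> i != j.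
  by move=> ui uj; apply: contraNneq ui => ->.
have u : uniq [:: n; s; w; e] by rewrite /= !inE !negb_or ns we !neq.
have [[] num] := uniq_numbering u.
  by exists n, s, e, w; have := numbering_swap23 num; split.
by exists n, s, w, e; split.
Qed.

(** Rotating the picture by a half-turn. *)
Lemma drawn_rotate t n s w e : drawn t n s w e -> drawn t s n e w.
Proof.
by case=> num *; split=> //; have := numbering_swap23 (numbering_swap01 num).
Qed.

Lemma drawn_colour t n s w e : drawn t n s w e ->
  nu (edge_of (t, edge_in_faces s e)) = red /\
  nu (edge_of (t, edge_in_faces s w)) = blue.
Proof.
case=> num dn ds uw ue; have u := numbering_uniq num.
have [[[[ns nw ne] [sn sw se]] [wn ws we]] [en es ew]] := uniq4_neq u.
have neq := (ns, nw, ne, sn, sw, se, wn, ws, we, en, es, ew).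
have setC4 (a b c d : 'I_4) : uniq [:: a; b; c; d] ->
    sval (edge_in_faces a b) = [set c; d].
  move=> v; rewrite val_edge_in_faces ?(setC2_ord4 v) //.
  by have [[[[-> _ _] _] _] _] := uniq4_neq v.
have topE : top_diag (@up V) t = [set n; s].
  rewrite -(setC4 w e) /= ?inE ?neq //; apply/esym/eqP.
  by rewrite eq_top_diag ?we // uw ue.
have botE : bot_diag (@up V) t = [set w; e].
  rewrite -(setC4 n s) /= ?inE ?neq //; apply/esym/eqP.
  by rewrite eq_bot_diag ?ns // dn ds.
case: num => sigma /negbT os [sn' ss' sw' se'].
have := vt_veering (v := V) (t := t) os; rewrite sn' ss' sw' se' => /(_ topE botE) col.
split.
  have [red_p _] := col (edge_in_faces s e); apply: red_p; left.
  by apply: setC4; rewrite /= !inE !neq.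
have [_ blue_p] := col (edge_in_faces s w); apply: blue_p; left.
by apply: setC4; rewrite /= !inE !neq.
Qed.

(** Whether the edge common to the faces [i] and [j] of [t] is the top
    diagonal of the tetrahedron immediately below the face [i]. *)
Definition leads t i j : bool :=
  if up (t, i) then up (t, j) else up ((glue t i).1, (glue t i).2 j).

Lemma leads_top t n s w e : drawn t n s w e ->
  forall j, j != w -> leads t w j = (j == e).
Proof.
case=> num dn ds uw ue; have u := numbering_uniq num.
have [[[[ns nw ne] [sn sw se]] [wn ws we]] [en es ew]] := uniq4_neq u.
move=> j; rewrite /leads uw.
have : j \in [:: n; s; w; e] by rewrite -(perm_mem (ord4_perm_eq u)) mem_index_enum.
rewrite !inE => /or4P[] /eqP ->; rewrite ?eqxx ?ne ?se ?ue //.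
- by rewrite (negbTE dn).
- by rewrite (negbTE ds).
Qed.

(** Here the veering condition enters. In the tetrahedron [t'] below the
    bottom face [s], two of the four faces are top ones: [s] itself, and one of
    those glued along [n], [w], [e], which decides the distinguished edge. In
    each case the orientation forces the position of the face [s] in the
    picture of [t'], and [t'] then imposes a colour on an edge of the face. If
    the second top face came from [n], the edge ne, blue in [t], would have to
    be red. In the other two cases the colour of the bottom diagonal we of [t]
    is determined. *)
Lemma leads_bottom t n s w e : drawn t n s w e ->
  forall j, j != s ->
  leads t s j =
  (j == if nu (edge_of (t, edge_in_faces n s)) is red then e else w).
Proof.
move=> D; have [num dn ds uw ue] := D; have u := numbering_uniq num.
have [[[[ns nw ne] [sn sw se]] [wn ws we]] [en es ew]] := uniq4_neq u.
have [_ blue_ne] := drawn_colour D.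
pose t' := (glue t s).1; pose tau : 'S_4 := (glue t s).2.
have up_s : up (t', tau s) by have := up_mate (vt_taut V) (t, s); rewrite ds.
have num' := numbering_image (glue_odd (vt_triangulation V) t s) num.
rewrite -/tau in num'; have u' := numbering_uniq num'.
have edge_tau j : j != s ->
    edge_of (t, edge_in_faces s j) = edge_of (t', edge_in_faces (tau s) (tau j)).
  move=> js; apply: (@edge_of_carry s).
  have := @carry_edge_turn (t, (s, j)); rewrite /axis /= (edge_in_facesC (tau j)).
  by apply; rewrite eq_sym.
have count_up : (up (t', tau n) + up (t', tau w) + up (t', tau e) = 1)%N.
  have := two_top_faces (vt_taut V) t'.
  rewrite -sum1_card big_mkcond (big_ord4 _ u') !inE up_s.
  by case: up; case: up; case: up.
have leadsE j : leads t s j = up (t', tau j) by rewrite /leads (negbTE ds).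
move=> j js; rewrite leadsE.
have : j \in [:: n; s; w; e] by rewrite -(perm_mem (ord4_perm_eq u)) mem_index_enum.
(* In each case [D'] turns the picture of [t'] so that the face [s] is its
   east face; the number of swaps leading to it is odd, as [tau] is. *)
case un: (up (t', tau n)) count_up => count_up.
  have [uw' ue'] : ~~ up (t', tau w) /\ ~~ up (t', tau e).
    by move: count_up; case: up; case: up.
  have D' : drawn t' (tau e) (tau w) (tau n) (tau s).
    split=> //.
    have := numbering_swap12 (numbering_swap01 (numbering_swap12
             (numbering_swap23 (numbering_swap12 num')))).
    exact.
  have [+ _] := drawn_colour D'.
  by rewrite edge_in_facesC -edge_tau ?blue_ne // ws.
case uw': (up (t', tau w)) count_up => count_up.
  have ue' : ~~ up (t', tau e) by move: count_up; case: up.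
  have D' : drawn t' (tau n) (tau e) (tau w) (tau s).
    split=> //; last by rewrite un.
    exact: numbering_swap12 (numbering_swap23 (numbering_swap12 num')).
  have [_ +] := drawn_colour (drawn_rotate D').
  rewrite edge_in_facesC -edge_tau ?ns // edge_in_facesC => ->.
  rewrite !inE => /or4P[] /eqP jE; subst j;
    rewrite ?eqxx ?un ?uw' ?(negbTE ue') ?nw ?ew //.
  by rewrite eqxx in js.
have ue' : up (t', tau e) by move: count_up; case: up.
have D' : drawn t' (tau w) (tau n) (tau e) (tau s).
  split=> //; try by rewrite ?un ?uw'.
  exact: numbering_swap23 (numbering_swap01 (numbering_swap12 num')).
have [+ _] := drawn_colour D'.
rewrite edge_in_facesC -edge_tau ?ns // edge_in_facesC => ->.
rewrite !inE => /or4P[] /eqP jE; subst j; rewrite ?eqxx ?un ?uw' ?ue' ?ne ?we //.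
by rewrite eqxx in js.
Qed.

Section FaceRelation.
Context (phi : F -> H V) (liftphi : is_lift phi).

(** The image under [DL] of the lift of the face [i] of [t] that lies in [1.t],
    which need not be the chosen lift of that triangle if [i] is a bottom
    face. *)
Definition face_image t i : freemod ZH (edge (@glue V)) :=
  \sum_(j | j != i)
    (if leads t i j then lifted_edge phi (t, edge_in_faces i j)
     else - lifted_edge phi (t, edge_in_faces i j)).

(** The chosen lift of a triangle is a top face of [1.b] for the tetrahedron
    [b] below it; for a bottom face of [t], it lies [phi] away from [1.t]. *)
Lemma DL_col_face t i :
  DL_col phi (triangle_of (t, i)) =
  gr_elt (if up (t, i) then 0 else phi (triangle_of (t, i))) *: face_image t i.
Proof.
rewrite /DL_col big_mkcondr big_triangle (up_mate (vt_taut V)) /face_image /leads.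
have [ui|ui] := boolP (up (t, i)); rewrite /= ?addr0 ?add0r big_edges_of_face.
  rewrite -[LHS]scale1r; congr (_ *: _); apply: eq_bigr => j ji.
  by rewrite eq_top_diag 1?eq_sym // ui.
set s := (glue t i).2; rewrite (reindex_inj (@perm_inj _ s)) /= scaler_sumr.
apply: eq_big => [j|j ji]; first by rewrite (inj_eq perm_inj).
have ij : i != j by rewrite eq_sym; move: ji; rewrite (inj_eq perm_inj).
rewrite eq_top_diag ?(inj_eq perm_inj) //.
have -> : up ((glue t i).1, s i).
  by have := up_mate (vt_taut V) (t, i); rewrite (negbTE ui).
have carry : carry_edge (@glue V) i (t, edge_in_faces i j)
    ((glue t i).1, edge_in_faces (s i) (s j)).
  have := @carry_edge_turn (t, (i, j)) ij.
  by rewrite /axis /= (edge_in_facesC (_ j)).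
have := lifted_edge_carry liftphi carry.
rewrite /crossing /= (negbTE ui) => ->.
by case: ifP => _; rewrite ?scalerN gr_eltK.
Qed.

(** The signs depend on the colour of the bottom diagonal; exchanging red and
    blue exchanges the roles of the two top faces. *)
Lemma face_image_relation t : exists eps : pred 'I_4,
  \sum_i (if eps i then - face_image t i else face_image t i) = 0.
Proof.
have [n [s [w [e D]]]] := drawn_exists t.
have [num _ _ _ _] := D; have u := numbering_uniq num.
have [[[[ns nw ne] [sn sw se]] [wn ws we]] [en es ew]] := uniq4_neq u.
have neq := (ns, nw, ne, sn, sw, se, wn, ws, we, en, es, ew).
pose G i j := lifted_edge phi (t, edge_in_faces i j).
pose L i k := \sum_(j | j != i) (if j == k then G i j else - G i j).
have Gsym i j : G i j = G j i by rewrite /G edge_in_facesC.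
have imageE i k :
    (forall j, j != i -> leads t i j = (j == k)) -> face_image t i = L i k.
  by move=> lead; apply: eq_bigr => j /lead ->.
have image_w := imageE _ _ (leads_top D).
have image_e := imageE _ _ (leads_top (drawn_rotate D)).
have image_s := imageE _ _ (leads_bottom D).
have image_n := imageE _ _ (leads_bottom (drawn_rotate D)).
have zero (a b c d : freemod ZH (edge (@glue V))) :
    a + b = c + d -> - c + a + b - d = 0.
  by move=> e1; rewrite -(addrA (- c)) e1 addKr subrr.
case col : (nu _) image_s image_n => image_s; rewrite edge_in_facesC col => image_n.
  exists (pred2 n w); rewrite (big_ord4 _ u) /= !eqxx ?neq /=.
  rewrite image_w image_e image_s image_n addrAC.
  exact/zero/(tet_faces_relation Gsym u).
exists (pred2 n e); rewrite (big_ord4 _ u) /= !eqxx ?neq ?orbT /=.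
rewrite image_w image_e image_s image_n.
by apply/zero/(tet_faces_relation Gsym); rewrite /= !inE !neq.
Qed.

(** A submodule containing the columns of three faces of a tetrahedron
    contains that of the fourth: up to units of the group ring, the four
    columns sum to zero. *)
Lemma fourth_column (W : freemod ZH (edge (@glue V)) -> Prop) x :
  W 0 -> (forall u v, W u -> W v -> W (u + v)) ->
  (forall (a : ZH) v, W v -> W (a *: v)) ->
  (forall i, i != x.2 -> W (DL_col phi (triangle_of (x.1, i)))) ->
  W (DL_col phi (triangle_of x)).
Proof.
case: x => t i /= W0 WD WZ others.
have WN v : W v -> W (- v) by rewrite -scaleN1r; exact: WZ.
have imageE j : face_image t j =
    gr_elt (- (if up (t, j) then 0 else phi (triangle_of (t, j)))) *:
      DL_col phi (triangle_of (t, j)).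
  rewrite DL_col_face; set h := (if _ then _ else _).
  by rewrite -{2}(opprK h) gr_eltK.
have [eps] := face_image_relation t.
rewrite (bigD1 i) //= => /eqP; rewrite addr_eq0 => /eqP rel.
have Wsum :
    W (\sum_(j | j != i) (if eps j then - face_image t j else face_image t j)).
  apply: (big_ind W) => // j ji.
  have Wj : W (face_image t j) by rewrite imageE; apply/WZ/others.
  by case: ifP => _ //; apply: WN.
rewrite DL_col_face; apply: WZ.
move: rel; case: (eps i) => [/oppr_inj ->//|->]; exact: WN.
Qed.

End FaceRelation.

End VeeringTriangulation.

(** * Equality of the images *)

Theorem proposition5p5 (V : veering_triangulation)
  (phi : triangle (@glue V) -> H V) (hphi : is_fundamental_domain phi)
  (Y : {set triangle (@glue V)}) (hY : spanning_tree Y) :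
  range (DL phi) = range (DL_Y phi Y).
Proof.
have colP : forall f, range (DL_Y phi Y) (DL_col phi f).
  apply: (tree_face_induction hY) => [f fY|x others].
    exact: (lincomb_delta (fun f : off_tree Y => DL_col phi (sval f))
      (exist _ f fY)).
  apply: (fourth_column (fd_lift hphi)) others.
  - by exists 0; rewrite ?raddf0.
  - by move=> _ _ [u1 _ <-] [u2 _ <-]; exists (u1 + u2); rewrite ?raddfD.
  - by move=> a _ [u _ <-]; exists (a *: u); rewrite ?linearZ.
apply/seteqP; split; apply: range_lincomb_sub => // f.
exact: (lincomb_delta (DL_col phi) (sval f)).
Qed.
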